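(* Fix $c>0$ and $0\le\alpha\le 1$, and for each $n$ put $t=\lfloor cn^{\alpha}\rfloor$; assume $1\le t\le \frac{n+1}{2}$ (for all large $n$). For each such $n$, let $\sigma$ be any sign assignment on the arcs of $K_{n+1}$ (as in the context) whose set $M$ of marked edges is a $t$-matching. Let $u\in\mathbb{C}^{\mathcal{A}}$ be the uniform state $u(a)=1/\sqrt{n(n+1)}$ for all $a\in\mathcal{A}$, and let $\psi_k=U_\sigma^k u$. Let $$\lambda_m=\frac{n-3+\sqrt{(n+3)^2-16t}}{2n}$$ (the largest eigenvalue of $T_\sigma$), $\theta_m=\arccos\lambda_m$, and $k_f=\lfloor \pi/(2\theta_m)\rfloor$. Then, as $n\to\infty$, $k_f=\Theta\big(n^{\frac{2-\alpha}{2}}\big)$, and the probability of finding the walker on a marked edge at time $k_f$, $$\sum_{e=xy\in M}\Big(|\psi_{k_f}((x,y))|^2+|\psi_{k_f}((y,x))|^2\Big),$$ equals $1-o(1)$. In particular, the quantum walk driven by $U_\sigma$ finds a marked edge with time complexity $O\big(n^{\frac{2-\alpha}{2}}\big)$.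
   Context: Setting. $K_{n+1}$ is the complete graph on the vertex set $V$ with $|V|=n+1$ ($n\ge 2$), edge set $E$; every vertex has degree $n$. The arc set is $\mathcal{A}=\{(x,y): x,y\in V, x\ne y\}$; for an arc $a=(x,y)$, $o(a)=x$ is its origin, $t(a)=y$ its terminus, and $a^{-1}=(y,x)$. A map $\sigma:\mathcal{A}\to\{\pm1\}$ is required to satisfy: $\sigma(a)=-1$ implies $\sigma(a^{-1})=1$. Put $\mathcal{M}=\{a\in\mathcal{A}:\sigma(a)=-1\}$, $\mathcal{M}^{-1}=\{a^{-1}:a\in\mathcal{M}\}$, $\tau(xy)=\sigma((x,y))\sigma((y,x))$ for $xy\in E$, and $M=\{e\in E:\tau(e)=-1\}$ (the marked edges); $\partial M$ is the set of endpoints of edges in $M$. A $t$-matching is a set of $t$ pairwise vertex-disjoint edges. Define $w(a)=-1/\sqrt{n}$ if $a\in\mathcal{M}$ and $w(a)=1/\sqrt{n}$ otherwise; $d_\sigma:\mathbb{C}^{\mathcal{A}}\to\mathbb{C}^V$ has entries $(d_\sigma)_{v,a}=w(a)$ if $t(a)=v$ and $0$ otherwise; $S$ on $\mathbb{C}^{\mathcal{A}}$ is the arc-reversal permutation, $S_{a,b}=1$ if $a=b^{-1}$ and $0$ otherwise. The time evolution operator is the unitary $U_\sigma=S(2d_\sigma^*d_\sigma-I_{\mathcal{A}})$, and $T_\sigma=d_\sigma S d_\sigma^*$ (a matrix on $\mathbb{C}^V$). *)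

(* Defs.v *)
From HB Require Import structures.
From mathcomp Require Import all_boot all_order all_algebra.
From mathcomp Require Import all_classical all_reals all_analysis.
Set Implicit Arguments. Unset Strict Implicit. Unset Printing Implicit Defensive.
Import Order.TTheory GRing.Theory Num.Theory.
Local Open Scope ring_scope.

Definition Vtx (n : nat) := 'I_n.+1.
Definition Arc (n : nat) := {p : Vtx n * Vtx n | p.1 != p.2}.

Definition org {n} (a : Arc n) : Vtx n := (val a).1.
Definition ter {n} (a : Arc n) : Vtx n := (val a).2.

Lemma arc_inv_subproof n (a : Arc n) : (val a).2 != (val a).1.
Proof. by rewrite eq_sym; exact: (valP a). Qed.

Definition arc_inv {n} (a : Arc n) : Arc n :=
  exist _ ((val a).2, (val a).1) (arc_inv_subproof a).

Definition sign_assignment {R : realType} {n} (sigma : Arc n -> R) : Prop :=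
  (forall a, sigma a = 1 \/ sigma a = -1) /\
  (forall a, sigma a = -1 -> sigma (arc_inv a) = 1).

Definition edge_of {n} (a : Arc n) : {set Vtx n} := [set org a; ter a].

Definition tau {R : realType} {n} (sigma : Arc n -> R) (a : Arc n) : R :=
  sigma a * sigma (arc_inv a).

Definition marked_edges {R : realType} {n} (sigma : Arc n -> R)
  : {set {set Vtx n}} :=
  [set edge_of a | a in [pred a : Arc n | tau sigma a == -1]].

Definition t_matching {n} (M : {set {set Vtx n}}) (t : nat) : Prop :=
  finset.trivIset M /\ #|M| = t.

Definition wgt {R : realType} {n} (sigma : Arc n -> R) (a : Arc n) : R :=
  (if sigma a == -1 then -1 else 1) / Num.sqrt (n%:R).

Definition dsig {R : realType} {n} (sigma : Arc n -> R) (psi : Arc n -> R)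
  : Vtx n -> R :=
  fun v => \sum_(a : Arc n | ter a == v) wgt sigma a * psi a.

(* d_sigma^* : C^V -> C^A (weights are real, so adjoint = transpose). *)
Definition dsig_adj {R : realType} {n} (sigma : Arc n -> R) (f : Vtx n -> R)
  : Arc n -> R :=
  fun a => wgt sigma a * f (ter a).

Definition Srev {R : realType} {n} (psi : Arc n -> R) : Arc n -> R :=
  fun a => psi (arc_inv a).

Definition Usig {R : realType} {n} (sigma : Arc n -> R) (psi : Arc n -> R)
  : Arc n -> R :=
  Srev (fun a => 2 * dsig_adj sigma (dsig sigma psi) a - psi a).

Definition uniform_state {R : realType} (n : nat) : Arc n -> R :=
  fun _ => 1 / Num.sqrt (n%:R * n.+1%:R).

Definition psi_k {R : realType} {n} (sigma : Arc n -> R) (k : nat) : Arc n -> R :=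
  iter k (Usig sigma) (@uniform_state R n).

Definition marked_prob {R : realType} {n} (sigma : Arc n -> R) (psi : Arc n -> R) : R :=
  \sum_(a : Arc n | edge_of a \in marked_edges sigma) `|psi a| ^+ 2.

Definition t_param {R : realType} (c alpha : R) (n : nat) : nat :=
  Num.truncn (c * (n%:R `^ alpha)).

Definition lambda_m {R : realType} (n t : nat) : R :=
  (n%:R - 3 + Num.sqrt ((n%:R + 3) ^+ 2 - 16 * t%:R)) / (2 * n%:R).

Definition theta_m {R : realType} (n t : nat) : R := acos (lambda_m (R:=R) n t).

Definition k_f {R : realType} (n t : nat) : nat :=
  Num.truncn (pi / (2 * theta_m (R:=R) n t)).

(* Main.v *)
Require Import Defs.
From HB Require Import structures.
From mathcomp Require Import all_boot all_order all_algebra.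
From mathcomp Require Import all_classical all_reals all_analysis.
From mathcomp Require Import ring lra.
Set Implicit Arguments. Unset Strict Implicit. Unset Printing Implicit Defensive.
Import Order.TTheory GRing.Theory Num.Theory.
Import numFieldNormedType.Exports.
Local Open Scope ring_scope.

(** Let [f] be the eigenfunction of [T_sigma] for [lambda_m]: it equals 1 off
the endpoints of the matching and [1 - d] on them, with [d = O(1/n)].  On the
plane spanned by [d_sigma^* f] and [S d_sigma^* f] the walk is a rotation by
[theta_m].  The sum of these two vectors vanishes on marked arcs and is, up to
normalization, within [O(1/sqrt n)] of the uniform state; their difference has
constant modulus on marked arcs.  After [k_f] steps the rotation has turned
the former into a multiple of the latter, whose mass on marked arcs is
[1 - O(1/n)].  Since [1 - lambda_m] is of order [t/n^2], the angle [theta_m]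
is of order [sqrt t / n]. *)

(** * Arcs and edges of the complete graph *)

Lemma arc_eq {n} (a b : Arc n) : org a = org b -> ter a = ter b -> a = b.
Proof.
case: a b => [[x y] xy] [[z w] zw]; rewrite /org /ter /= => xz yw.
by apply: val_inj; rewrite /= xz yw.
Qed.

Lemma arc_invK {n} : involutive (@arc_inv n).
Proof. by move=> a; apply: arc_eq. Qed.

Lemma edge_of_inj {n} (a b : Arc n) :
  edge_of a = edge_of b -> a = b \/ a = arc_inv b.
Proof.
move=> /finset.setP eab.
have ob := eab (org b); have tb := eab (ter b); have oa := eab (org a).
move: ob tb oa; rewrite !inE !eqxx /= ?orbT => ob tb oa.
have := valP a; have := valP b; rewrite -/(org a) -/(ter a) -/(org b) -/(ter b).
move=> nb na.
case/orP: ob => /eqP ob; case/orP: tb => /eqP tb.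
- by rewrite ob tb eqxx in nb.
- by left; apply: arc_eq.
- by right; apply: arc_eq.
- by rewrite ob tb eqxx in nb.
Qed.

Lemma sum_in_arcs {V : nmodType} {n} (F : Vtx n -> V) v :
  \sum_(a : Arc n | ter a == v) F (org a) = \sum_(w | w != v) F w.
Proof.
rewrite (partition_big (@org n) (fun w => w != v)) /=; last first.
  by move=> a /eqP <-; exact: valP a.
apply: eq_bigr => w wv.
rewrite (big_pred1 (exist _ (w, v) wv : Arc n)) //= => a; apply/andP/eqP.
  by move=> [/eqP ta /eqP oa]; apply: arc_eq.
by move=> ->; rewrite /ter /org /= !eqxx.
Qed.

Lemma in_degree {R : realType} {n} (v : Vtx n) :
  \sum_(a : Arc n | ter a == v) (1 : R) = n%:R.
Proof.
rewrite (sum_in_arcs (fun=> 1)) sumr_const.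
have := cardC1 v; rewrite card_ord /= => e; congr (_%:R); rewrite -[RHS]e.
by apply: eq_card => x; rewrite !inE.
Qed.

Lemma sum_arcs_const {R : realType} n (x : R) :
  \sum_(a : Arc n) x = x * (n%:R * n.+1%:R).
Proof.
rewrite (partition_big (@ter n) xpredT) //=.
transitivity (\sum_(v : Vtx n) x * n%:R).
  apply: eq_bigr => v _; rewrite -(in_degree v) big_distrr /=.
  by apply: eq_bigr => a _; rewrite mulr1.
by rewrite sumr_const card_ord -[LHS]mulr_natr mulrA.
Qed.

(** * Marked arcs, the matching, and the eigenfunction of [T_sigma] *)

Section Marked.
Context {R : realType} {n : nat} (sigma : Arc n -> R).
Hypothesis sgn : sign_assignment sigma.

Definition marked (a : Arc n) : bool := tau sigma a == -1.
Definition boundary : {set Vtx n} := finset.cover (marked_edges sigma).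

Lemma tau_inv a : tau sigma (arc_inv a) = tau sigma a.
Proof. by rewrite /tau arc_invK mulrC. Qed.

Lemma marked_inv a : marked (arc_inv a) = marked a.
Proof. by rewrite /marked tau_inv. Qed.

Lemma edge_of_marked a : (edge_of a \in marked_edges sigma) = marked a.
Proof.
apply/imsetP/idP => [[b mb eab]|ma]; last by exists a.
by case: (edge_of_inj eab) => ->; rewrite ?marked_inv.
Qed.

Lemma unmarked_sign a : ~~ marked a -> sigma a = 1.
Proof.
move=> nm; case: (sgn.1 a) => // sa; move: nm.
by rewrite /marked /tau sa (sgn.2 _ sa) mulr1 eqxx.
Qed.

Lemma one_neqN1 : (1 == -1 :> R) = false.
Proof. by rewrite gt_eqF //; lra. Qed.

Lemma marked_wgt a : marked a -> wgt sigma (arc_inv a) = - wgt sigma a.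
Proof.
rewrite /marked /tau /wgt.
case: (sgn.1 a) => ->; case: (sgn.1 (arc_inv a)) => ->;
  rewrite ?mulr1 ?mul1r ?mulrNN ?mulr1 ?one_neqN1 ?eqxx // => _; ring.
Qed.

Lemma unmarked_wgt a : ~~ marked a -> wgt sigma a = 1 / Num.sqrt n%:R.
Proof. by move=> /unmarked_sign; rewrite /wgt => ->; rewrite one_neqN1. Qed.

Lemma wgt_sqr a : wgt sigma a ^+ 2 = n%:R^-1.
Proof.
rewrite /wgt expr_div_n sqr_sqrtr ?ler0n //.
by case: ifP => _; rewrite ?sqrrN expr1n div1r.
Qed.

(** These products are the off-diagonal entries of [T_sigma], which is therefore the simple random
    walk on the complete graph with the sign flipped on marked edges. *)
Lemma wgt_mul_inv a :
  wgt sigma a * wgt sigma (arc_inv a) = (1 - 2 * (marked a)%:R) / n%:R.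
Proof.
case: (boolP (marked a)) => ma.
  rewrite marked_wgt // mulrN -expr2 wgt_sqr /=; ring.
rewrite !unmarked_wgt ?marked_inv // -expr2 expr_div_n sqr_sqrtr ?ler0n //=.
by rewrite expr1n; ring.
Qed.

Lemma marked_ter a : marked a -> ter a \in boundary.
Proof.
move=> ma; apply/bigcupP; exists (edge_of a); rewrite ?edge_of_marked //.
by rewrite !inE eqxx orbT.
Qed.

Lemma marked_org a : marked a -> org a \in boundary.
Proof. by rewrite -marked_inv => /marked_ter. Qed.

Hypothesis matching : finset.trivIset (marked_edges sigma).

(** In a matching, two marked edges through [v] coincide. Of the two orientations of that edge, only
    one ends at [v]. *)
Lemma marked_in_arcs v :
  \sum_(a | (ter a == v) && marked a) (1 : R) = (v \in boundary)%:R.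
Proof.
case: (boolP (v \in boundary)) => [/bigcupP[e]|vB]; last first.
  by apply: big1 => a /andP[/eqP ta /marked_ter]; rewrite ta (negbTE vB).
move=> /imsetP[b0 mb0 ->] vb0.
have [b [mb tb]] : exists b, marked b /\ ter b = v.
  move: vb0; rewrite !inE => /orP[]/eqP ->; last by exists b0.
  by exists (arc_inv b0); rewrite marked_inv.
rewrite (big_pred1 b) //= => a; apply/andP/eqP => [[/eqP ta ma]|->]; last first.
  by rewrite tb.
have va : v \in edge_of a by rewrite !inE ta eqxx orbT.
have vb : v \in edge_of b by rewrite !inE tb eqxx orbT.
have eab : edge_of a = edge_of b.
  apply: contraTeq va => nab.
  have := finset.trivIsetP matching _ _ _ _ nab.
  rewrite !edge_of_marked => /(_ ma mb); rewrite disjoint_sym.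
  by move/disjointFr ->.
case: (edge_of_inj eab) => // ab; have := valP b.
by rewrite -/(org b) -/(ter b) tb -ta ab eqxx.
Qed.

Lemma card_boundary : #|boundary| = (2 * #|marked_edges sigma|)%N.
Proof.
rewrite /boundary -(eqP matching) mulnC -sum_nat_const.
apply: eq_bigr => e /imsetP[a _ ->].
by rewrite /edge_of cards2 (valP a).
Qed.

Lemma sum_boundary : \sum_v (v \in boundary)%:R = 2 * #|marked_edges sigma|%:R :> R.
Proof.
rewrite -natrM -card_boundary -sum1_card natr_sum big_mkcond /= [RHS]big_mkcond.
by apply: eq_bigr => v _; case: ifP; case: (v \in boundary).
Qed.

Lemma sum_marked : \sum_(a | marked a) (1 : R) = 2 * #|marked_edges sigma|%:R.
Proof.
rewrite (partition_big (@ter n) xpredT) //= -sum_boundary.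
apply: eq_bigr => v _; rewrite -marked_in_arcs.
by apply: eq_bigl => a; rewrite andbC.
Qed.

Definition step_fun (d : R) (v : Vtx n) : R := 1 - d * (v \in boundary)%:R.

(** The first equation on [l] and [d] is the eigenvalue equation at a vertex off [boundary]; the
    second is the one at a vertex of [boundary], simplified by the first. *)
Lemma discriminant_eigenfunction (l d : R) :
  (0 < n)%N ->
  n%:R * (1 - l) = 2 * #|marked_edges sigma|%:R * d ->
  d * (n%:R + 3 - n%:R * (1 - l)) = 2 ->
  forall v, dsig sigma (Srev (dsig_adj sigma (step_fun d))) v = l * step_fun d v.
Proof.
move=> n0 H1 H2 v; rewrite /dsig /Srev /dsig_adj.
have nn0 : n%:R != 0 :> R by rewrite pnatr_eq0 -lt0n.
(* Both ends of a marked arc lie in [boundary], so each sign flip replaces [1 - d] by its opposite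
   and costs [2 * (1 - d)]. *)
transitivity (n%:R^-1 * (\sum_(a : Arc n | ter a == v) step_fun d (org a)
   - 2 * (1 - d) * \sum_(a | (ter a == v) && marked a) 1)).
  rewrite big_mkcondr /= [2 * _ * _]big_distrr /= -sumrB big_distrr /=.
  apply: eq_bigr => a _; rewrite mulrA wgt_mul_inv.
  rewrite -[ter (arc_inv a)]/(org a) /step_fun; case: ifP => [ma|_] /=.
    by rewrite marked_org //=; ring.
  by ring.
rewrite sum_in_arcs marked_in_arcs.
have -> : \sum_(w | w != v) step_fun d w
    = n.+1%:R - d * (2 * #|marked_edges sigma|%:R) - step_fun d v.
  have -> : n.+1%:R - d * (2 * #|marked_edges sigma|%:R) = \sum_w step_fun d w.
    by rewrite /step_fun sumrB -big_distrr /= sum_boundary sumr_const card_ord.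
  by rewrite [X in _ = X - _](bigD1 v) //= addrAC subrr add0r.
apply: (mulfI nn0); rewrite mulVKf // /step_fun -natr1.
case: (v \in boundary) => /=; nra.
Qed.

End Marked.

(** * The walk operator: linearity, isometry, rotation on an invariant plane *)

Section Walk.
Context {R : realType} {n : nat} (sigma : Arc n -> R).
Implicit Types (psi phi : Arc n -> R) (f : Vtx n -> R).

Lemma Usig_lin x y psi phi :
  Usig sigma (fun a => x * psi a + y * phi a) =
  (fun a => x * Usig sigma psi a + y * Usig sigma phi a).
Proof.
apply/funext => a; rewrite /Usig /Srev /dsig_adj.
have -> v : dsig sigma (fun a => x * psi a + y * phi a) v =
    x * dsig sigma psi v + y * dsig sigma phi v.
  rewrite /dsig !big_distrr -big_split /=; apply: eq_bigr => b _; ring.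
ring.
Qed.

Lemma iter_Usig_lin k x y psi phi :
  iter k (Usig sigma) (fun a => x * psi a + y * phi a) =
  (fun a => x * iter k (Usig sigma) psi a + y * iter k (Usig sigma) phi a).
Proof. by elim: k => //= k ->; rewrite Usig_lin. Qed.

Hypothesis n0 : (0 < n)%N.

(** In-degree [n] balances squared weights [1/n]. Consequently [2 d_sigma^* d_sigma - I] is a
    reflection. *)
Lemma dsig_adjK f : dsig sigma (dsig_adj sigma f) = f.
Proof.
apply/funext => v; rewrite /dsig /dsig_adj.
transitivity (f v / n%:R * \sum_(a : Arc n | ter a == v) 1).
  rewrite big_distrr /=; apply: eq_bigr => a /eqP ->.
  by rewrite mulrA -expr2 wgt_sqr; ring.
by rewrite in_degree divfK // pnatr_eq0 -lt0n.
Qed.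

Lemma Usig_isometry psi :
  \sum_a (Usig sigma psi a) ^+ 2 = \sum_a psi a ^+ 2.
Proof.
rewrite /Usig /Srev /dsig_adj.
rewrite (reindex_inj (can_inj (@arc_invK n))) /=.
under eq_bigr => a _ do rewrite arc_invK.
rewrite (partition_big (@ter n) xpredT) //= [RHS](partition_big (@ter n) xpredT) //=.
apply: eq_bigr => v _; set g := dsig sigma psi.
(* Expanding the square at each vertex leaves a multiple of [g v * (d_sigma d_sigma^* g - g) v],
   which vanishes. *)
transitivity (4 * (g v * (\sum_(a | ter a == v) wgt sigma a * (wgt sigma a * g (ter a)))
  - g v * \sum_(a | ter a == v) wgt sigma a * psi a)
  + \sum_(a | ter a == v) psi a ^+ 2); last first.
  have -> : \sum_(a | ter a == v) wgt sigma a * (wgt sigma a * g (ter a)) = g v.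
    by rewrite -[RHS]/(g v) -{2}(dsig_adjK g).
  by rewrite -/(dsig sigma psi v) -/g subrr mulr0 add0r.
rewrite !big_distrr -sumrB big_distrr -big_split /=.
by apply: eq_bigr => a /eqP ->; ring.
Qed.

Lemma iter_Usig_isometry k psi :
  \sum_a (iter k (Usig sigma) psi a) ^+ 2 = \sum_a psi a ^+ 2.
Proof. by elim: k => //= k <-; rewrite Usig_isometry. Qed.

Definition sum_state f a : R := dsig_adj sigma f a + Srev (dsig_adj sigma f) a.
Definition diff_state f a : R := Srev (dsig_adj sigma f) a - dsig_adj sigma f a.

(* With [p = d_sigma^* f] and [q = S p], the walk maps [p] to [q] and [q] to
   [2 * cos th * q - p]. *)
Lemma iter_Usig_sum_state f th k :
  sin th != 0 ->
  (forall v, dsig sigma (Srev (dsig_adj sigma f)) v = cos th * f v) ->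
  iter k (Usig sigma) (sum_state f) =
  (fun a => cos (k%:R * th) * sum_state f a
     + (1 + cos th) / sin th * sin (k%:R * th) * diff_state f a).
Proof.
move=> s0 eig.
have Up a : Usig sigma (dsig_adj sigma f) a = Srev (dsig_adj sigma f) a.
  rewrite /Usig dsig_adjK /Srev; ring.
have Uq a : Usig sigma (Srev (dsig_adj sigma f)) a =
    2 * cos th * Srev (dsig_adj sigma f) a - dsig_adj sigma f a.
  rewrite /Usig {1}/Srev /dsig_adj eig /Srev arc_invK; ring.
elim: k => [|k IH].
  apply/funext => a /=; rewrite mul0r cos0 sin0; ring.
rewrite iterS IH Usig_lin; apply/funext => a.
(* In the basis of sum and difference the step has diagonal entries [cos th]. The factor
   [(1 + cos th) / sin th], the cotangent of [th / 2], is the ratio of the norms of the two vectors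
   and turns the step into a rotation. *)
have -> : Usig sigma (sum_state f) a =
    cos th * sum_state f a + (1 + cos th) * diff_state f a.
  have -> : sum_state f = fun a =>
      1 * dsig_adj sigma f a + 1 * Srev (dsig_adj sigma f) a.
    by apply/funext => b; rewrite !mul1r.
  rewrite Usig_lin Up Uq /diff_state; ring.
have -> : Usig sigma (diff_state f) a =
    (cos th - 1) * sum_state f a + cos th * diff_state f a.
  have -> : diff_state f = fun a =>
      1 * Srev (dsig_adj sigma f) a + (-1) * dsig_adj sigma f a.
    by apply/funext => b; rewrite mul1r mulN1r.
  rewrite Usig_lin Up Uq /sum_state; ring.
have -> : k.+1%:R * th = k%:R * th + th by rewrite -natr1 mulrDl mul1r.
rewrite cosD sinD.
have : cos th ^+ 2 + sin th ^+ 2 = 1 by exact: cos2Dsin2.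
set C := cos th; set S := sin th in s0 * => CS.
have e : (1 + C) / S * (C - 1) = - S.
  apply: (mulIf s0); transitivity ((1 + C) * (C - 1)); first by field; exact: s0.
  nra.
set ck := cos _; set sk := sin _; set A := sum_state f a; set B := diff_state f a.
transitivity (ck * (C * A + (1 + C) * B) + (sk * A * ((1 + C) / S * (C - 1))
   + (1 + C) / S * sk * C * B)); first by ring.
rewrite e; field; exact: s0.
Qed.

End Walk.

(** * A sine estimate and the gap [1 - lambda_m] *)

Lemma sin_mean_value {R : realType} (x : R) : 0 <= x <= pi / 2 ->
  cos x * x <= sin x <= x.
Proof.
move=> /andP[x0 xp].
have [|c + ] := @MVT_segment R sin cos 0 x x0 (fun y _ => is_derive_sin y).
  exact/continuous_subspaceT/continuous_sin.
rewrite in_itv /= sin0 !subr0 => /andP[c0 cx] ->.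
rewrite ler_wpM2r //=; last first.
  have p0 := pi_ge0 R.
  rewrite leNgt ltr_cos -?leNgt // in_itv /= ?c0 ?x0 /=; lra.
rewrite -[leRHS]mul1r ler_wpM2r // cos_le1 //.
Qed.

(** The number [n * e] is the smaller root of [x ^ 2 - (n + 3) * x + 4 * t]. The quadratic equation
    and the bound by 2 replace the square root in all later estimates. *)
Lemma lambda_m_gap {R : realType} (n t : nat) :
  (1 < n)%N -> (t.*2 <= n.+1)%N ->
  let e : R := 1 - lambda_m n t in
  [/\ 0 <= e, n%:R * e <= 2 & e * (n%:R ^+ 2 + 3 * n%:R - n%:R ^+ 2 * e) = 4 * t%:R].
Proof.
move=> n1 tn e.
have N1 : 2 <= n%:R :> R by rewrite (ler_nat _ 2).
have T : 2 * t%:R <= n%:R + 1 :> R by rewrite -natrM mul2n natr1 ler_nat.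
have T0 : 0 <= t%:R :> R by rewrite ler0n.
have D0 : 0 <= (n%:R + 3) ^+ 2 - 16 * t%:R :> R by nra.
set r : R := Num.sqrt ((n%:R + 3) ^+ 2 - 16 * t%:R).
have r2 : r ^+ 2 = (n%:R + 3) ^+ 2 - 16 * t%:R by rewrite sqr_sqrtr.
have r0 : 0 <= r by exact: sqrtr_ge0.
have ne : 2 * (n%:R * e) = n%:R + 3 - r.
  by rewrite /e /lambda_m -/r; field; lra.
(* At the extreme [2 * t = n + 1] the radicand is [(n + 3) ^ 2 - 8 * (n + 1) = (n - 1) ^ 2]. *)
have rlo : n%:R - 1 <= r by rewrite leNgt; apply/negP => h; nra.
have rhi : r <= n%:R + 3 by rewrite leNgt; apply/negP => h; nra.
split; [|lra|nra].
by rewrite -(pmulr_rge0 _ (_ : 0 < n%:R)); lra.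
Qed.

(** * Lower bound on the success probability for fixed [n] and [k] *)

Section FiniteBound.
Context {R : realType} {n : nat} (sigma : Arc n -> R).
Hypotheses (sgn : sign_assignment sigma) (n0 : (0 < n)%N).
Hypothesis matching : finset.trivIset (marked_edges sigma).
Let M := #|marked_edges sigma|.

Lemma sum_state_marked f a : marked sigma a -> f (org a) = f (ter a) ->
  sum_state sigma f a = 0.
Proof.
move=> ma fa; rewrite /sum_state /Srev /dsig_adj marked_wgt //.
rewrite -[ter (arc_inv a)]/(org a) fa; ring.
Qed.

Lemma diff_state_marked f a : marked sigma a -> f (org a) = f (ter a) ->
  diff_state sigma f a ^+ 2 = 4 * f (ter a) ^+ 2 / n%:R.
Proof.
move=> ma fa; rewrite /diff_state /Srev /dsig_adj marked_wgt //.
rewrite -[ter (arc_inv a)]/(org a) fa -(wgt_sqr sigma a); ring.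
Qed.

Lemma sum_state_unmarked f a : ~~ marked sigma a ->
  sum_state sigma f a = (f (ter a) + f (org a)) / Num.sqrt n%:R.
Proof.
move=> ma; rewrite /sum_state /Srev /dsig_adj !unmarked_wgt ?marked_inv //.
rewrite -[ter (arc_inv a)]/(org a); ring.
Qed.

Lemma step_fun_marked d a : marked sigma a ->
  step_fun sigma d (org a) = 1 - d /\ step_fun sigma d (ter a) = 1 - d.
Proof.
by move=> ma; rewrite /step_fun marked_org ?marked_ter //= mulr1.
Qed.

(** The scaling factor makes the residual vanish on arcs with both ends off [boundary]. *)
Definition residual (d : R) (a : Arc n) : R :=
  uniform_state a - (2 * Num.sqrt n.+1%:R)^-1 * sum_state sigma (step_fun sigma d) a.

(** On a marked arc [sum_state] is 0 and the whole uniform amplitude remains. On any other arc the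
    mean of [step_fun] over the two ends differs from 1 by at most [d]. *)
Lemma residual_sqr d a : 0 <= d ->
  residual d a ^+ 2 <= ((marked sigma a)%:R + d ^+ 2) / (n%:R * n.+1%:R).
Proof.
move=> d0; rewrite /residual /uniform_state sqrtrM ?ler0n //.
have s0 : Num.sqrt n%:R != 0 :> R by rewrite gt_eqF // sqrtr_gt0 ltr0n.
have s1 : Num.sqrt n.+1%:R != 0 :> R by rewrite gt_eqF // sqrtr_gt0 ltr0n.
have e0 : n%:R * n.+1%:R = (Num.sqrt n%:R * Num.sqrt n.+1%:R) ^+ 2 :> R.
  by rewrite exprMn !sqr_sqrtr ?ler0n.
rewrite [in leRHS]e0.
set r := Num.sqrt n%:R in s0 *; set q := Num.sqrt n.+1%:R in s1 *.
case: (boolP (marked sigma a)) => ma /=.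
  have [fo ft] := step_fun_marked d ma.
  rewrite sum_state_marked ?fo ?ft // mulr0 subr0 expr_div_n expr1n.
  rewrite ler_wpM2r ?invr_ge0 ?sqr_ge0 //; nra.
rewrite sum_state_unmarked // -/r add0r.
set b := step_fun _ _ _ + _.
have -> : 1 / (r * q) - (2 * q)^-1 * (b / r) = (1 - b / 2) / (r * q).
  by field; rewrite s0 s1.
rewrite expr_div_n ler_wpM2r ?invr_ge0 ?sqr_ge0 //.
by rewrite /b /step_fun; case: (_ \in _); case: (_ \in _) => /=; nra.
Qed.

Lemma residual_norm d : 0 <= d ->
  \sum_a residual d a ^+ 2 <= 2 * M%:R / (n%:R * n.+1%:R) + d ^+ 2.
Proof.
move=> d0.
apply: le_trans (ler_sum _ (fun a _ => residual_sqr a d0)) _.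
rewrite -big_distrl big_split /= sum_arcs_const.
have -> : \sum_a (marked sigma a)%:R = 2 * M%:R :> R.
  rewrite -(sum_marked matching) [RHS]big_mkcond /=.
  by apply: eq_bigr => a _; case: (marked sigma a).
by rewrite mulrDl mulfK // mulf_neq0 ?pnatr_eq0 // -lt0n.
Qed.

Lemma uniform_state_norm : \sum_(a : Arc n) uniform_state a ^+ 2 = 1 :> R.
Proof.
rewrite /uniform_state sum_arcs_const expr_div_n sqr_sqrtr
  ?expr1n ?div1r -?natrM ?ler0n //.
by rewrite mulVf // pnatr_eq0 muln_eq0 (gtn_eqF n0).
Qed.

Lemma marked_probE (psi : Arc n -> R) :
  marked_prob sigma psi = \sum_(a | marked sigma a) psi a ^+ 2.
Proof.
by apply: eq_big => a; rewrite ?edge_of_marked // real_normK // num_real.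
Qed.

Lemma marked_sum_le (psi : Arc n -> R) :
  \sum_(a | marked sigma a) psi a ^+ 2 <= \sum_a psi a ^+ 2.
Proof.
rewrite big_mkcond /=; apply: ler_sum => a _.
by case: ifP => // _; exact: sqr_ge0.
Qed.

Lemma marked_prob_le1 k : marked_prob sigma (psi_k sigma k) <= 1.
Proof.
rewrite marked_probE; apply: le_trans (marked_sum_le _) _.
by rewrite /psi_k iter_Usig_isometry // uniform_state_norm.
Qed.

(** The uniform state is a multiple of [sum_state] plus the residual. The first part is followed
    exactly by the rotation; the second keeps its norm. The parameter [eta] weighs the cross term
    between them. *)
Lemma marked_prob_ge k th d eta :
  0 < eta -> 0 <= d -> sin th != 0 ->
  n%:R * (1 - cos th) = 2 * M%:R * d ->
  d * (n%:R + 3 - n%:R * (1 - cos th)) = 2 ->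
  (1 - eta) * (2 * M%:R * ((1 + cos th) / sin th * sin (k%:R * th) * (1 - d)) ^+ 2
     / (n%:R * n.+1%:R))
  - (2 * M%:R / (n%:R * n.+1%:R) + d ^+ 2) / eta
  <= marked_prob sigma (psi_k sigma k).
Proof.
move=> eta0 d0 s0 H1 H2; set K := (1 + cos th) / sin th * sin _.
have ed := discriminant_eigenfunction sgn matching n0 H1 H2.
pose s : R := (2 * Num.sqrt n.+1%:R)^-1.
pose f := step_fun sigma d.
have uE : @uniform_state R n = fun a => s * sum_state sigma f a + 1 * residual d a.
  by apply/funext => a; rewrite mul1r /residual addrC subrK.
rewrite marked_probE /psi_k uE iter_Usig_lin.
pose y := iter k (Usig sigma) (residual d).
pose x a := s * iter k (Usig sigma) (sum_state sigma f) a.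
(* The cosine term disappears on marked arcs together with [sum_state], leaving the sine term, of
   constant modulus there. *)
have xE a : marked sigma a -> x a ^+ 2 = (K * (1 - d)) ^+ 2 / (n%:R * n.+1%:R).
  move=> ma; have [fo ft] := step_fun_marked d ma.
  rewrite /x (iter_Usig_sum_state n0 _ s0 ed) sum_state_marked ?fo ?ft //.
  rewrite mulr0 add0r -/K mulrA exprMn diff_state_marked ?fo ?ft //.
  have nn0 : n%:R != 0 :> R by rewrite pnatr_eq0 -lt0n.
  have Sn0 : n.+1%:R != 0 :> R by rewrite pnatr_eq0.
  have s2 : s ^+ 2 = (4 * n.+1%:R)^-1.
    by rewrite exprVn exprMn sqr_sqrtr ?ler0n //; congr (_^-1); ring.
  rewrite [(s * _) ^+ 2]exprMn s2; move: nn0 Sn0; clearbody K.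
  by move: (n%:R) (n.+1%:R) => u v u0 v0; field; rewrite u0 v0.
have -> : 2 * M%:R * (K * (1 - d)) ^+ 2 / (n%:R * n.+1%:R) =
    \sum_(a | marked sigma a) x a ^+ 2.
  rewrite (eq_bigr _ xE) -[in RHS](mul1r (_ / _)) -big_distrl /= (sum_marked matching).
  by rewrite -mulrA.
apply: (@le_trans _ _ (\sum_(a | marked sigma a)
  ((1 - eta) * x a ^+ 2 - y a ^+ 2 / eta))).
  rewrite sumrB -big_distrr -big_distrl /= lerB // ler_wpM2r ?invr_ge0 ?(ltW eta0) //.
  apply: le_trans (marked_sum_le _) _.
  by rewrite /y iter_Usig_isometry // residual_norm.
apply: ler_sum => a _; rewrite -/(x a) mul1r -/(y a) -subr_ge0.
(* Completing the square gives [(x + y) ^ 2 >= (1 - eta) * x ^ 2 - y ^ 2 / eta]. *)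
have -> : (x a + y a) ^+ 2 - ((1 - eta) * x a ^+ 2 - y a ^+ 2 / eta) =
    eta * (x a + y a / eta) ^+ 2 + y a ^+ 2.
  by field; rewrite gt_eqF.
by apply: addr_ge0; [apply: mulr_ge0; [exact: ltW|]|]; exact: sqr_ge0.
Qed.

End FiniteBound.

(** * Size of the angle [theta_m] and of the stopping time [k_f] *)

Section Angle.
Context {R : realType} (n t : nat).
Hypotheses (n4 : (4 <= n)%N) (t1 : (1 <= t)%N) (tn : (t.*2 <= n.+1)%N).
Let th : R := theta_m n t.
Let e : R := 1 - lambda_m n t.

Let N4 : 4 <= n%:R :> R. Proof. by rewrite (ler_nat _ 4). Qed.
Let T1 : 1 <= t%:R :> R. Proof. by rewrite (ler_nat _ 1). Qed.

Lemma gap_gt0 : 0 < e.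
Proof.
have [e0 _ H] := @lambda_m_gap R n t (ltn_trans (isT : 1 < 3)%N n4) tn.
rewrite lt_def e0 andbT; apply/eqP => ee; move: H T1.
by rewrite -/e ee; lra.
Qed.

Lemma gap_half : e <= 1 / 2.
Proof.
have [_ ne _] := @lambda_m_gap R n t (ltn_trans (isT : 1 < 3)%N n4) tn.
move: ne N4; rewrite -/e => ne n4'; have := gap_gt0; nra.
Qed.

(** With [w = n * e] the quadratic reads [w * (n + 3 - w) = 4 * t], where [0 <= w <= 2]. The
    constant 4 of the upper bound has to be sharp, since the limit 1 of the success probability
    depends on it. *)
Lemma gap_bounds : 2 * t%:R <= n%:R ^+ 2 * e /\ (n%:R ^+ 2 + n%:R) * e <= 4 * t%:R.
Proof.
have [_ ne H] := @lambda_m_gap R n t (ltn_trans (isT : 1 < 3)%N n4) tn.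
move: ne H; rewrite -/e => ne H; have e0 := gap_gt0; have h4 := N4.
have : 0 <= n%:R * e by rewrite mulr_ge0 // ltW.
have nw : n%:R ^+ 2 * e = n%:R * (n%:R * e) by ring.
have {}H : n%:R * (n%:R * e) + 3 * (n%:R * e) - (n%:R * e) ^+ 2 = 4 * t%:R.
  by rewrite -H; ring.
rewrite [(_ + _) * e]mulrDl nw; move: (n%:R * e) ne H => w ne H w0.
have : 0 <= w * (n%:R - 3) by apply: mulr_ge0; lra.
have : 0 <= w * (2 - w) by apply: mulr_ge0; lra.
by have := sqr_ge0 w; split; lra.
Qed.

Lemma cos_theta_m : cos th = 1 - e.
Proof.
rewrite /th /theta_m acosK /e; first by rewrite opprB addrC subrK.
by rewrite in_itv /=; have := gap_gt0; have := gap_half; rewrite /e; lra.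
Qed.

Lemma theta_m_itv : 0 < th <= pi / 2.
Proof.
have e0 := gap_gt0; have e2 := gap_half; rewrite /e in e0 e2.
have th0 : 0 < th by apply: acos_gt0; lra.
have thp : th <= pi by apply: acos_lepi; lra.
rewrite th0 leNgt; apply/negP => h.
have : cos th < cos (pi / 2).
  by rewrite ltr_cos // in_itv /= ?(ltW th0) //; have := pi_gt0 R; lra.
by rewrite cos_pihalf cos_theta_m; have := gap_half; lra.
Qed.

Lemma sin_theta_m_sqr : sin th ^+ 2 = e * (2 - e).
Proof. by rewrite sin2cos2 cos_theta_m; ring. Qed.

Lemma sin_theta_m_gt0 : 0 < sin th.
Proof.
have /andP[th0 thp] := theta_m_itv.
by apply: sin_gt0_pi; have := pi_gt0 R; lra.
Qed.

(** Since [e <= 1 / 2], [sin th ^ 2 = e * (2 - e)] lies between [e] and [2 * e]. Also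
    [cos th >= 1 / 2], so [sin th <= th <= 2 * sin th], whence [e <= th ^ 2 <= 8 * e]. *)
Lemma theta_m_sqr : 2 * t%:R <= n%:R ^+ 2 * th ^+ 2 <= 32 * t%:R.
Proof.
have /andP[th0 thp] := theta_m_itv.
have /andP[lo hi] : cos th * th <= sin th <= th.
  by apply: sin_mean_value; rewrite ltW.
have s0 := sin_theta_m_gt0; have s2 := sin_theta_m_sqr.
have e0 := gap_gt0; have e2 := gap_half.
have [b1 b2] := gap_bounds.
rewrite cos_theta_m in lo.
have l1 : e <= th ^+ 2 by nra.
have l2 : th <= 2 * sin th by nra.
have l3 : th ^+ 2 <= 8 * e by nra.
have N0 : 0 <= n%:R ^+ 2 :> R by exact: sqr_ge0.
have ne0 : 0 <= n%:R * e by rewrite mulr_ge0 // ltW.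
have := ler_wpM2l N0 l1; have := ler_wpM2l N0 l3.
by move: b1 b2; rewrite [(_ + _) * e]mulrDl => *; apply/andP; split; lra.
Qed.

(** As [th <= pi / 2], the number being truncated is at least 1, and truncation then loses at most
    half of it. *)
Lemma k_f_bounds : pi / (4 * th) <= (@k_f R n t)%:R <= pi / (2 * th).
Proof.
have /andP[th0 thp] := theta_m_itv.
have q1 : 1 <= pi / (2 * th) by rewrite ler_pdivlMr; lra.
have q0 : 0 <= pi / (2 * th) by lra.
rewrite /k_f -/th truncn_le q0 andbT.
have := truncnS_gt (pi / (2 * th)); rewrite -[X in _ < X]natr1.
have : 1 <= (Num.truncn (pi / (2 * th)))%:R :> R.
  by rewrite (ler_nat _ 1) truncn_gt0.
have -> : pi / (4 * th) = pi / (2 * th) / 2.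
  by field; rewrite gt_eqF.
lra.
Qed.

(** By truncation, [k_f * th] falls short of [pi / 2] by less than [th]. *)
Lemma sin_k_f : cos th <= sin ((@k_f R n t)%:R * th).
Proof.
have /andP[th0 thp] := theta_m_itv.
have q0 : 0 <= pi / (2 * th) by rewrite divr_ge0 ?pi_ge0 // mulr_ge0 // ltW.
have /andP[lo hi] := truncn_itv q0.
rewrite -/(@k_f R n t) in lo hi; have p0 := pi_gt0 R.
rewrite ler_pdivlMr in lo; last by lra.
rewrite -[X in _ < X]natr1 ltr_pdivrMr in hi; last by lra.
rewrite -cosBpihalf -[leRHS]cosN opprB leNgt ltr_cos -?leNgt ?in_itv /=; lra.
Qed.

End Angle.

(** * Success probability at time [k_f], through Bernoulli's inequality *)

Lemma one_sub_expr_ge {R : realDomainType} (x : R) (m : nat) :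
  0 <= x <= 1 -> 1 - m%:R * x <= (1 - x) ^+ m.
Proof.
move=> /andP[x0 x1]; elim: m => [|m IH]; first by rewrite mul0r subr0.
have h : 0 <= (1 - x) ^+ m by rewrite exprn_ge0 // subr_ge0.
have h1 : (1 - x) ^+ m <= 1 by rewrite exprn_ile1 //; lra.
rewrite exprS; have -> : m.+1%:R * x = m%:R * x + x.
  by rewrite -natr1 mulrDl mul1r.
nra.
Qed.

Section FiniteTime.
Context {R : realType} (n t : nat) (sigma : Arc n -> R).
Hypotheses (n4 : (4 <= n)%N) (t1 : (1 <= t)%N) (tn : (t.*2 <= n.+1)%N).
Hypotheses (sgn : sign_assignment sigma) (mat : t_matching (marked_edges sigma) t).

Lemma marked_prob_k_f (eta : R) : 0 < eta <= 1 ->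
  1 - eta - 12 / (eta * n%:R) <= marked_prob sigma (psi_k sigma (@k_f R n t)).
Proof.
move=> /andP[eta0 eta1]; have [matching Mt] := mat.
have n0 : (0 < n)%N by apply: leq_trans n4.
have N4 : 4 <= n%:R :> R by rewrite (ler_nat _ 4).
have T1 : 1 <= t%:R :> R by rewrite (ler_nat _ 1).
have T2 : 2 * t%:R <= n%:R + 1 :> R by rewrite -natrM mul2n natr1 ler_nat.
have [_ ne H] := @lambda_m_gap R n t (ltn_trans (isT : 1 < 3)%N n4) tn.
have e0 := @gap_gt0 R n t n4 t1 tn.
have [_ b2] := @gap_bounds R n t n4 t1 tn.
have ct := @cos_theta_m R n t n4 t1 tn.
have s2 := @sin_theta_m_sqr R n t n4 t1 tn.
have st := @sin_theta_m_gt0 R n t n4 t1 tn.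
have sk := @sin_k_f R n t n4 t1 tn.
move: ne H e0 b2 ct s2 st sk.
set e := 1 - _; set th := theta_m n t; set k := k_f n t => ne H e0 b2 ct s2 st sk.
(* This solves the eigenvalue equation on [boundary]; the one off [boundary] then becomes the
   quadratic equation for [e]. *)
pose d : R := 2 / (n%:R + 3 - n%:R * e).
have dD : d * (n%:R + 3 - n%:R * e) = 2 by rewrite divfK // gt_eqF //; lra.
have d0 : 0 <= d by rewrite divr_ge0 //; lra.
have ee : 1 - cos th = e by rewrite ct opprB addrC subrK.
have H1 : n%:R * (1 - cos th) = 2 * #|marked_edges sigma|%:R * d.
  rewrite ee Mt; have D0 : n%:R + 3 - n%:R * e != 0 by rewrite gt_eqF //; lra.
  apply: (mulIf D0); rewrite -[RHS]mulrA dD.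
  by transitivity (4 * t%:R : R); [rewrite -H; ring|ring].
have H2 : d * (n%:R + 3 - n%:R * (1 - cos th)) = 2 by rewrite ee.
have sn0 : sin th != 0 by rewrite gt_eqF.
apply: le_trans (marked_prob_ge sgn n0 matching k eta0 d0 sn0 H1 H2).
rewrite Mt; set X := _ * _ ^+ 2 / _; set Y := _ / _ + _.
(* One small quantity dominating both [e] and [d]. *)
pose x : R := 2 / n%:R.
have xn : x * n%:R = 2 by rewrite divfK // gt_eqF //; lra.
have x0 : 0 < x by rewrite divr_gt0 //; lra.
have x1 : x <= 1 / 2 by nra.
have ex : e <= x by nra.
have dx : d <= x by nra.
have G0 : 0 < n%:R * n.+1%:R :> R by rewrite mulr_gt0 ?ltr0n.
(* Five factors [1 - x] arise: one from [1 - e / 2], two from the squared sine and two from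
   [(1 - d) ^ 2]. The rest is at least 1 by the sharp bound on [n * (n + 1) * e]. *)
have X_ge : 1 - 5 * x <= X.
  apply: le_trans (one_sub_expr_ge 5 (_ : 0 <= x <= 1)) _; first by lra.
  rewrite /X ler_pdivlMr // -(ler_pM2r e0) exprMn [(_ / _ * _) ^+ 2]exprMn.
  have k2 : ((1 + cos th) / sin th) ^+ 2 * e = 2 - e.
    rewrite expr_div_n s2 ct; field; rewrite !gt_eqF //; lra.
  have y0 : 0 <= 1 - x by lra.
  have hs : (1 - x) ^+ 2 <= sin (k%:R * th) ^+ 2.
    by rewrite lerXn2r ?nnegrE //; lra.
  have hd : (1 - x) ^+ 2 <= (1 - d) ^+ 2 by rewrite lerXn2r ?nnegrE //; lra.
  have hsd := ler_pM (sqr_ge0 _) (sqr_ge0 _) hs hd.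
  have he : 1 - x <= 1 - e / 2 by lra.
  have h5 : (1 - x) ^+ 5 <= (1 - e / 2) * (sin (k%:R * th) ^+ 2 * (1 - d) ^+ 2).
    rewrite (_ : (1 - x) ^+ 5 = (1 - x) * ((1 - x) ^+ 2 * (1 - x) ^+ 2)); last by ring.
    by apply: ler_pM; rewrite ?mulr_ge0 ?sqr_ge0.
  have GE : n%:R * n.+1%:R * e <= 4 * t%:R.
    by rewrite -[n.+1%:R]natr1 (_ : _ * _ * e = (n%:R ^+ 2 + n%:R) * e) //; ring.
  apply: (@le_trans _ _ ((1 - x) ^+ 5 * (4 * t%:R))).
    by rewrite -mulrA ler_wpM2l // exprn_ge0.
  rewrite [leRHS](_ : _ = 2 * t%:R * (((1 + cos th) / sin th) ^+ 2 * e)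
    * (sin (k%:R * th) ^+ 2 * (1 - d) ^+ 2)); last by ring.
  have t0 : 0 <= 4 * t%:R :> R by lra.
  by rewrite k2; have := ler_wpM2r t0 h5; lra.
have Y_le : Y <= x.
  have Y1 : 2 * t%:R / (n%:R * n.+1%:R) <= x / 2.
    rewrite ler_pdivrMr // mulrA -[n.+1%:R]natr1 (_ : x / 2 * n%:R = x * n%:R / 2).
      by rewrite xn; lra.
    by ring.
  have d2 : d ^+ 2 <= x / 2 by nra.
  by rewrite /Y (splitr x) lerD.
(* Five of the six units pay for [X], the last one for [Y / eta]. *)
have -> : 12 / (eta * n%:R) = 6 * (x / eta).
  by rewrite /x; field; rewrite !gt_eqF //; lra.
have xeta : x <= x / eta by rewrite ler_pdivlMr // ler_piMr // ltW.
have Yeta : Y / eta <= x / eta.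
  by rewrite ler_pM2r // invr_gt0.
have : (1 - eta) * (1 - 5 * x) <= (1 - eta) * X by rewrite ler_wpM2l // subr_ge0.
nra.
Qed.

End FiniteTime.

(** * Asymptotics in [n] *)

Lemma t_param_bounds {R : realType} (c alpha : R) (n : nat) : 0 < c ->
  (1 <= t_param c alpha n)%N ->
  c * n%:R `^ alpha <= 2 * (t_param c alpha n)%:R <= 2 * (c * n%:R `^ alpha).
Proof.
move=> c0 t1; have z0 : 0 <= c * n%:R `^ alpha by rewrite mulr_ge0 ?powR_ge0 // ltW.
have /andP[lo hi] := truncn_itv z0.
rewrite -/(t_param c alpha n) -[X in _ < X]natr1 in lo hi.
have : 1 <= (t_param c alpha n)%:R :> R by rewrite (ler_nat _ 1).
by move=> h; apply/andP; split; lra.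
Qed.

(** This turns [n ^ 2 * th ^ 2] of order [n ^ alpha] into a bounded [th * n ^ ((2 - alpha) / 2)]. *)
Lemma powR_split_sqr {R : realType} (alpha x : R) : 0 < x ->
  (x `^ ((2 - alpha) / 2)) ^+ 2 * x `^ alpha = x ^+ 2.
Proof.
move=> x0; rewrite -powR_mulrn ?powR_ge0 // -powRrM divfK ?pnatr_eq0 //.
rewrite -powRD ?subrK; last by rewrite gt_eqF ?implybT.
by rewrite powR_mulrn // ltW.
Qed.

Lemma k_f_Theta {R : realType} (c alpha : R) (n : nat) :
  0 < c -> (4 <= n)%N ->
  (1 <= t_param c alpha n)%N -> ((t_param c alpha n).*2 <= n.+1)%N ->
  pi / (4 * Num.sqrt (32 * c)) * n%:R `^ ((2 - alpha) / 2)
    <= (@k_f R n (t_param c alpha n))%:R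
    <= pi / (2 * Num.sqrt c) * n%:R `^ ((2 - alpha) / 2).
Proof.
move=> c0 n4 t1 tn; set t := t_param c alpha n in t1 tn *.
have N0 : 0 < n%:R :> R by rewrite ltr0n; apply: leq_trans n4.
have /andP[lo hi] := @theta_m_sqr R n t n4 t1 tn.
have /andP[th0 _] := @theta_m_itv R n t n4 t1 tn.
have /andP[klo khi] := @k_f_bounds R n t n4 t1 tn.
have /andP[tlo thi] := t_param_bounds c0 t1; rewrite -/t in tlo thi.
have PQ := powR_split_sqr alpha N0.
have P0 := powR_gt0 ((2 - alpha) / 2) N0; have Q0 := powR_gt0 alpha N0.
move: lo hi th0 klo khi tlo thi PQ P0 Q0.
set th := theta_m n t; set P := _ `^ ((2 - alpha) / 2); set Q := _ `^ alpha.
move=> lo hi th0 klo khi tlo thi PQ P0 Q0.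
(* Here [2 * t >= c * Q] gives the lower constant and [32 * t <= 32 * c * Q] the upper one. *)
have hP : c <= (th * P) ^+ 2 <= 32 * c.
  rewrite exprMn -PQ in lo hi *.
  by apply/andP; split; rewrite -(ler_pM2r Q0); lra.
have r0 : 0 < Num.sqrt c by rewrite sqrtr_gt0.
have q0 : 0 < Num.sqrt (32 * c) by rewrite sqrtr_gt0 mulr_gt0.
have thP0 : 0 < th * P by rewrite mulr_gt0.
have /andP[h1 h2] : Num.sqrt c <= th * P <= Num.sqrt (32 * c).
  rewrite -(ger0_norm (ltW thP0)) -sqrtr_sqr.
  by case/andP: hP => h1 h2; rewrite !ler_wsqrtr.
apply/andP; split.
  apply: le_trans klo; rewrite -mulrA ler_wpM2l ?pi_ge0 //.
  rewrite mulrC -[leRHS]mul1r ler_pdivrMr ?mulr_gt0 // mulrAC ler_pdivlMr ?mulr_gt0 //.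
  lra.
apply: le_trans khi _; rewrite -mulrA ler_wpM2l ?pi_ge0 //.
rewrite [leRHS]mulrC -[leLHS]mul1r ler_pdivlMr ?mulr_gt0 //.
rewrite mulrAC ler_pdivrMr ?mulr_gt0 //.
lra.
Qed.

Theorem theorem1p1 (R : realType) (c alpha : R) :
  0 < c -> 0 <= alpha <= 1 ->
  (exists N0 : nat, forall n : nat, (N0 <= n)%N ->
      (1 <= t_param c alpha n)%N /\ ((t_param c alpha n).*2 <= n.+1)%N) ->
  (* k_f = Theta(n^{(2-alpha)/2}) *)
  (exists C1 C2 : R, 0 < C1 /\ 0 < C2 /\
     exists N : nat, forall n : nat, (N <= n)%N ->
       C1 * (n%:R `^ ((2 - alpha) / 2)) <= (k_f (R:=R) n (t_param c alpha n))%:R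
       <= C2 * (n%:R `^ ((2 - alpha) / 2)))
  /\
  (* success probability at time k_f is 1 - o(1), uniformly in sigma *)
  (forall eps : R, 0 < eps ->
     exists N : nat, forall n : nat, (N <= n)%N ->
       forall sigma : Arc n -> R,
         sign_assignment sigma ->
         t_matching (marked_edges sigma) (t_param c alpha n) ->
         `| marked_prob sigma (psi_k sigma (k_f (R:=R) n (t_param c alpha n))) - 1 | < eps).
Proof.
move=> c0 _ [N0 HN]; split.
  exists (pi / (4 * Num.sqrt (32 * c))), (pi / (2 * Num.sqrt c)).
  have r0 : 0 < Num.sqrt c by rewrite sqrtr_gt0.
  have q0 : 0 < Num.sqrt (32 * c) by rewrite sqrtr_gt0 mulr_gt0.
  do 2![split; first by rewrite divr_gt0 ?pi_gt0 ?mulr_gt0].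
  exists (maxn N0 4) => n; rewrite geq_max => /andP[/HN[t1 tn] n4].
  exact: k_f_Theta.
move=> eps eps0; pose eta := Num.min (eps / 2) 1.
have eta0 : 0 < eta by rewrite lt_min ltr01 andbT divr_gt0.
have eta1 : eta <= 1 by rewrite ge_min lexx orbT.
have eta2 : eta <= eps / 2 by rewrite ge_min lexx.
(* Beyond [N1] the error [12 / (eta * n)] is below [eps / 2]; the other half of [eps] covers
   [eta]. *)
pose N1 := (Num.truncn (24 / (eta * eps))).+1.
exists (maxn N0 (maxn 4 N1)) => n; rewrite !geq_max.
move=> /and3P[/HN[t1 tn] n4 nN] sigma sgn mat.
have n0 : (0 < n)%N by apply: leq_trans n4.
have lo := marked_prob_k_f n4 t1 tn sgn mat (eta := eta).
have := marked_prob_le1 sigma n0 (@k_f R n (t_param c alpha n)).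
have /lo : 0 < eta <= 1 by rewrite eta0.
have small : 12 / (eta * n%:R) < eps / 2.
  have : 24 / (eta * eps) < n%:R.
    by apply: lt_le_trans (truncnS_gt _) _; rewrite ler_nat.
  rewrite !ltr_pdivrMr ?mulr_gt0 ?ltr0n //; lra.
by move=> {}lo hi; rewrite ltr_norml; apply/andP; split; lra.
Qed.
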